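(* Let $\Gamma=\{X_n\}_{n\in\mathbb N_0}$ be a difference-bounded supermartingale adapted to a filtration $\{\mathcal F_n\}_{n\in\mathbb N_0}$ satisfying: 1. $X_0$ is a constant random variable; 2. for all $n\in\mathbb N_0$ and all $\omega$: (i) $X_n(\omega)\ge0$ and (ii) $X_n(\omega)=0$ implies $X_{n+1}(\omega)=0$; 3. there exists $\delta\in(0,\infty)$ such that for all $n\in\mathbb N_0$, it holds a.s. that $X_n>0$ implies $\mathbb E(|X_{n+1}-X_n|\mid\mathcal F_n)\ge\delta$. Then $\mathbb P(Z_\Gamma<\infty)=1$ and the function $k\mapsto\mathbb P(Z_\Gamma\ge k)$ is in $\mathcal O\!\left(\frac1{\sqrt k}\right)$.
   Context: All random variables live on a probability space $(\Omega,\mathcal F,\mathbb P)$; $\mathbb N_0$ is the set of nonnegative integers. Supermartingale: adapted, $\mathbb E(|X_n|)<\infty$ and $\mathbb E(X_{n+1}\mid\mathcal F_n)\le X_n$ a.s. for all $n$. Difference-bounded: there is $c\in(0,\infty)$ with $|X_{n+1}-X_n|\le c$ a.s. for every $n\in\mathbb N_0$. The stopping time $Z_\Gamma$ is $Z_\Gamma(\omega):=\min\{n\in\mathbb N_0: X_n(\omega)\le0\}$, with $\min\emptyset:=\infty$. *)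

(* Defs.v *)
From HB Require Import structures.
From mathcomp Require Import all_boot all_order all_algebra.
From mathcomp Require Import all_classical all_reals all_analysis.

Set Implicit Arguments.
Unset Strict Implicit.
Unset Printing Implicit Defensive.

Import Order.TTheory GRing.Theory Num.Theory.
Import numFieldNormedType.Exports.

Local Open Scope classical_set_scope.
Local Open Scope ring_scope.

Definition filtration d (T : measurableType d) (F : nat -> set (set T)) :=
  [/\ forall n, sigma_algebra [set: T] (F n),
      forall n, F n `<=` measurable &
      forall m n, (m <= n)%N -> F m `<=` F n].

Definition measurable_wrt (T : Type) (R : realType) (G : set (set T))
    (f : T -> R) :=
  forall B : set R, measurable B -> G (f @^-1` B).

(* [Y] is a version of E(X | G), for an integrable [X] and a sub-sigma-algebra
   [G].  Versions exist (Radon-Nikodym) and any two are almost surely equal, so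
   an almost sure assertion about E(X | G) is written as: some version
   satisfies it almost surely. *)
Definition is_cond_exp d (T : measurableType d) (R : realType)
    (P : probability T R) (G : set (set T)) (X Y : T -> R) :=
  [/\ measurable_wrt G Y,
      P.-integrable [set: T] (EFin \o Y) &
      forall A, G A ->
        (\int[P]_(w in A) (Y w)%:E = \int[P]_(w in A) (X w)%:E)%E].

Definition supermartingale d (T : measurableType d) (R : realType)
    (P : probability T R) (F : nat -> set (set T)) (X : nat -> T -> R) :=
  [/\ forall n, measurable_wrt (F n) (X n),
      forall n, P.-integrable [set: T] (EFin \o X n) &
      forall n, exists2 Y, is_cond_exp P (F n) (X n.+1) Y &
        {ae P, forall w, Y w <= X n w}].

Definition difference_bounded d (T : measurableType d) (R : realType)
    (P : probability T R) (X : nat -> T -> R) :=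
  exists2 c : R, 0 < c &
    forall n, {ae P, forall w, `|X n.+1 w - X n w| <= c}.

Definition stopping_time_Z (T : Type) (R : realType) (X : nat -> T -> R)
    (w : T) : \bar R :=
  match pselect (exists n, X n w <= 0) with
  | left hit => (ex_minn hit)%:R%:E
  | right _ => +oo%E
  end.

(* Main.v *)
Require Import Defs.
From HB Require Import structures.
From mathcomp Require Import all_boot all_order all_algebra.
From mathcomp Require Import all_classical all_reals all_analysis.
From mathcomp Require Import measurable_realfun.
From mathcomp Require Import ring lra.

Set Implicit Arguments.
Unset Strict Implicit.
Unset Printing Implicit Defensive.

Import Order.TTheory GRing.Theory Num.Theory.
Import numFieldNormedType.Exports.

Local Open Scope classical_set_scope.
Local Open Scope ring_scope.

(* With f(x) = 1/(1 + t x) and D = X_{n+1} - X_n, there is the exact identity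
   f(X_{n+1}) - f(X_n) = - t D f(X_n)^2 + t^2 D^2 f(X_n)^2 f(X_{n+1}).
   The first term has nonnegative mean by the supermartingale property; in the
   second, D^2 >= 2 delta |D| - delta^2 on {X_n > 0}, so E(|D| | F_n) >= delta
   gives a gain of order t^2 (P(X_n > 0) - t E X_n), where t E X_n (Markov's
   inequality) pays for the event {X_n > 1/t} on which f(X_n) is small.
   Since f(X_k) - f(X_0) <= t X_0, summing over n < k bounds P(Z >= k) by
   t X_0 + O(1/(t k)), and t = 1/sqrt k gives both claims. *)

(** * The pointwise inequality for one increment *)

Lemma inv_affine_increment (R : realType) (t c delta x y : R) :
  0 < t -> t <= 1 -> 0 < c -> 0 < delta -> 0 <= x -> 0 <= y ->
  `|y - x| <= c -> (x = 0 -> y = 0) ->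
  t * ((1 + t * x)^-1 ^+ 2 * (x - y)) +
  2 * delta * t ^+ 2 *
    ((1 + t * x)^-1 ^+ 2 * (1 + t * x + t * c)^-1 *
      (`|y - x| - delta * (0 < x)%R%:R)) +
  t ^+ 2 * delta ^+ 2 * (4 * (2 + c))^-1 * ((0 < x)%R%:R - t * x) <=
  (1 + t * y)^-1 - (1 + t * x)^-1.
Proof.
move=> t0 t1 c0 d0 x0 y0 dc xy.
have a0 : 0 < 1 + t * x by nra.
have b0 : 0 < 1 + t * y by nra.
have e0 : 0 < 1 + t * x + t * c by nra.
have c2 : 0 < 2 + c by lra.
have k0 : 0 < 4 * (2 + c) by lra.
have -> : (1 + t * y)^-1 - (1 + t * x)^-1 =
    t * ((1 + t * x)^-1 ^+ 2 * (x - y)) +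
    t ^+ 2 * ((1 + t * x)^-1 ^+ 2 * (1 + t * y)^-1 * `|y - x| ^+ 2).
  rewrite real_normK ?num_real//; field.
  by rewrite !gt_eqF.
rewrite -[leLHS]addrA lerD2l.
set a := (1 + t * x)^-1; set b := (1 + t * y)^-1.
set e := (1 + t * x + t * c)^-1; set k := (4 * (2 + c))^-1.
(* Since [y <= x + c], the denominator [1 + t * x + t * c] dominates [1 + t * y]. Passing from [b]
   to [e] loses little and leaves a weight [a ^+ 2 * e] that depends on [x] alone, so conditional
   information can be tested against it. *)
have eb : e <= b.
  rewrite lef_pV2 ?posrE//; move: dc; rewrite ler_norml => /andP[_ dc]; nra.
have ap : 0 < a by rewrite invr_gt0.
have ep : 0 < e by rewrite invr_gt0.
have kp : 0 < k by rewrite invr_gt0.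
have h0 : 0 < a ^+ 2 * e by rewrite mulr_gt0// exprn_gt0.
have t20 : 0 < t ^+ 2 by rewrite exprn_gt0.
have st : t ^+ 2 * (a ^+ 2 * e * `|y - x| ^+ 2) <=
          t ^+ 2 * (a ^+ 2 * b * `|y - x| ^+ 2).
  rewrite ler_pM2l// ler_wpM2r ?sqr_ge0// ler_pM2l// exprn_gt0//.
apply: le_trans st.
(* At [x = 0] absorption forces [y = 0], and every remaining term vanishes. *)
have [xp|] := ltP 0 x; last first.
  move=> xle; have xe : x = 0 by lra.
  by rewrite xe xy// subrr normr0 !(mulr0,subr0,addr0,expr0n,mulr0).
(* The linear factor [1 - t * x] stands in for the indicator of [t * x <= 1], so that only the mean
   of [x] is needed later. Where [t * x <= 1], the denominators are at most [4] and [2 + c] (as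
   [t <= 1]), which explains [k]; elsewhere the left side is negative. *)
have hk : k * (1 - t * x) <= a ^+ 2 * e.
  have [tx|tx] := leP (t * x) 1; last first.
    by apply: le_trans (ltW h0); rewrite pmulr_rle0//; lra.
  apply: (@le_trans _ _ k).
    by rewrite ger_pMr// lerBlDr lerDl mulr_ge0// ltW.
  rewrite /a /e /k exprVn -invfM lef_pV2 ?posrE ?mulr_gt0 ?exprn_gt0//.
  have h4 : (1 + t * x) ^+ 2 <= 4 by nra.
  have h2 : 1 + t * x + t * c <= 2 + c by nra.
  by apply: ler_pM => //; rewrite ?exprn_ge0 ?ltW.
rewrite (_ : true%:R = 1 :> R)// mulr1; set D := `|y - x|.
have d2 : 0 < delta ^+ 2 by rewrite exprn_gt0.
have := ler_wpM2l (ltW d2) hk.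
(* Expanding the square gives [D^2 >= 2 delta (D - delta) + delta^2]; the term [delta^2] is the
   gain, and [hk] bounds its weight from below. *)
have : 0 <= (a ^+ 2 * e) * (D - delta) ^+ 2 by rewrite mulr_ge0 ?sqr_ge0 ?ltW.
move=> ha hb.
have : t ^+ 2 * (2 * delta * (a ^+ 2 * e * (D - delta)) +
                 delta ^+ 2 * k * (1 - t * x)) <=
  t ^+ 2 * (a ^+ 2 * e * D ^+ 2) by rewrite ler_pM2l//; nra.
move=> hc; apply: le_trans hc; rewrite le_eqVlt; apply/orP; left; apply/eqP; ring.
Qed.

(** * Real-valued integrals, and weights that are functions of a random variable *)

Section Rintegral_extra.
Context d (T : measurableType d) (R : realType) (mu : {measure set T -> \bar R}).

Lemma ae_Rintegral_ge0 (D : set T) (W : T -> R) : measurable D ->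
  mu.-integrable D (EFin \o W) -> {ae mu, forall w, D w -> 0 <= W w} ->
  0 <= \int[mu]_(w in D) W w.
Proof.
move=> mD iW W0; rewrite /Rintegral.
have mW : measurable_fun D W.
  by apply/measurable_EFinP; case/integrableP: iW.
rewrite (ae_eq_integral (EFin \o (fun w => `|W w|)))//.
- by apply/fine_ge0/integral_ge0 => w _; rewrite lee_fin.
- exact/measurable_EFinP.
- exact/measurable_EFinP/measurableT_comp.
- by apply: filterS W0 => w h Dw /=; rewrite ger0_norm// h.
Qed.

Lemma integrable_normr (D : set T) (f : T -> R) : mu.-integrable D (EFin \o f) ->
  mu.-integrable D (EFin \o (fun w => `|f w|)).
Proof. exact: integrable_norm. Qed.

Lemma integrable_addr (D : set T) (f g : T -> R) : measurable D ->
  mu.-integrable D (EFin \o f) -> mu.-integrable D (EFin \o g) ->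
  mu.-integrable D (EFin \o (fun w => f w + g w)).
Proof. by move=> mD intf intg; exact: (integrableD mD intf intg). Qed.

Lemma integrable_subr (D : set T) (f g : T -> R) : measurable D ->
  mu.-integrable D (EFin \o f) -> mu.-integrable D (EFin \o g) ->
  mu.-integrable D (EFin \o (fun w => f w - g w)).
Proof. by move=> mD intf intg; exact: (integrableB mD intf intg). Qed.

Lemma integrable_scaler (D : set T) (r : R) (f : T -> R) : measurable D ->
  mu.-integrable D (EFin \o f) -> mu.-integrable D (EFin \o (fun w => r * f w)).
Proof. by move=> mD intf; exact: (integrableZl mD r intf). Qed.

Lemma bounded_mul_integrable (f W : T -> R) :
  measurable_fun setT f -> (forall w, 0 <= f w <= 1) ->
  mu.-integrable setT (EFin \o W) ->
  mu.-integrable setT (EFin \o (fun w => f w * W w)).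
Proof.
move=> mf f01 iW.
have mW : measurable_fun setT W by apply/measurable_EFinP; case/integrableP: iW.
apply: (le_integrable _ _ _ iW) => //.
  by apply/measurable_EFinP/measurable_funM.
move=> w _ /=; rewrite lee_fin normrM.
have /andP[f0 f1] := f01 w.
by rewrite ger0_norm// ler_piMl.
Qed.

Lemma integrable_patch (A : set T) (W : T -> R) : measurable A ->
  mu.-integrable setT (EFin \o W) -> mu.-integrable setT (EFin \o (W \_ A)).
Proof.
move=> mA iW; rewrite -restrict_EFin.
apply/(integrable_restrict mu mA measurableT); rewrite setTI.
exact: integrableS measurableT mA (@subsetT _ A) iW.
Qed.

(* Subtracting half the indicator of [phi >= 1/2] from [phi] leaves half a
   function with values in [0, 1], so each step halves the error bound. *)
Lemma Rintegral_comp_mul_ge0 (X W : T -> R) (phi : R -> R) :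
  measurable_fun setT X -> mu.-integrable setT (EFin \o W) ->
  (forall B, measurable B -> 0 <= \int[mu]_(w in X @^-1` B) W w) ->
  measurable_fun setT phi -> (forall x, 0 <= phi x <= 1) ->
  0 <= \int[mu]_w (phi (X w) * W w).
Proof.
move=> mX iW hW mphi phi01.
have approx n : forall phi : R -> R, measurable_fun setT phi ->
    (forall x, 0 <= phi x <= 1) ->
    - (2^-1 ^+ n * \int[mu]_w `|W w|) <= \int[mu]_w (phi (X w) * W w).
  elim: n => [|n IHn] f mf f01.
    rewrite expr0 mul1r; have /lerNnormlW := le_normr_Rintegral measurableT
      (bounded_mul_integrable (measurableT_comp mf mX) (fun w => f01 (X w)) iW).
    apply: le_trans; rewrite lerN2.
    apply: le_Rintegral => //.
    - apply: integrable_normr; apply: bounded_mul_integrable => [|w|//].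
        exact: measurableT_comp.
      exact: f01.
    - exact: integrable_normr.
    - move=> w _; rewrite normrM; have /andP[f0 f1] := f01 (X w).
      by rewrite ger0_norm// ler_piMl.
  pose B := f @^-1` `[2^-1, +oo[%classic.
  have mB : measurable B by rewrite -[B]setTI; exact: mf.
  pose g x := 2 * f x - \1_B x.
  have mg : measurable_fun setT g.
    apply: measurable_funB; first exact: measurable_funM.
    exact: measurable_indic.
  have g01 x : 0 <= g x <= 1.
    rewrite /g indicE; case: (boolP (x \in B)).
      rewrite inE /B /= in_itv/= andbT => h.
      by have /andP[] := f01 x; lra.
    rewrite notin_setE /B /= in_itv/= andbT => /negP; rewrite -ltNge => h.
    by have /andP[] := f01 x; lra.
  have mXB : measurable (X @^-1` B) by rewrite -[_ @^-1` _]setTI; exact: mX.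
  have -> : \int[mu]_w (f (X w) * W w) =
      2^-1 * (\int[mu]_(w in X @^-1` B) W w + \int[mu]_w (g (X w) * W w)).
    rewrite (Rintegral_mkcond _ (X @^-1` B)) -RintegralD//; last 2 first.
    - exact: integrable_patch.
    - apply: bounded_mul_integrable => [|w|//]; last exact: g01.
      exact: measurableT_comp.
    rewrite -RintegralZl//; last first.
      apply: integrable_addr => //.
      - exact: integrable_patch.
      - apply: bounded_mul_integrable => [|w|//]; last exact: g01.
        exact: measurableT_comp.
    apply: eq_Rintegral => w _; rewrite patchE /g indicE.
    rewrite (_ : (w \in X @^-1` B) = (X w \in B)); last by rewrite !mem_setE.
    case: ifP => _.
      by rewrite (_ : true%:R = 1 :> R)//; field.
    by rewrite (_ : false%:R = 0 :> R)// (_ : point = 0 :> R)//; field.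
  have := IHn _ mg g01; have := hW _ mB.
  rewrite exprS; set u := _ ^+ n * _.
  rewrite -mulrA -/u; lra.
apply/ler_addgt0Pl => e e0.
pose M := \int[mu]_w `|W w|.
have M0 : 0 <= M by exact: Rintegral_ge0.
have [n hn] : exists n, 2^-1 ^+ n * M <= e.
  (* From [M / e < m <= 2^m] the error [M / 2^m] is at most [e]. *)
  have [m hm] : exists m : nat, M / e < m%:R.
    exists (Num.truncn (M / e)).+1; exact: truncnS_gt.
  exists m; rewrite exprVn mulrC ler_pdivrMr ?exprn_gt0//.
  rewrite mulrC -ler_pdivrMr//; apply: (le_trans (ltW hm)).
  by rewrite -natrX ler_nat ltnW// ltn_expl.
have := approx n phi mphi phi01; rewrite -/M; lra.
Qed.
End Rintegral_extra.

(** * Weights of the form [1/(a + b |x|)] *)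

(** The absolute value keeps the denominator positive on the whole line, hence the function
    continuous; on the nonnegative values taken by the process it changes nothing. *)
Lemma measurable_inv_affine_normr (R : realType) (a b : R) : 0 < a -> 0 <= b ->
  measurable_fun setT (fun x : R => (a + b * `|x|)^-1).
Proof.
move=> a0 b0; apply: continuous_measurable_fun => x.
apply: cvgV; first by rewrite gt_eqF// ltr_pwDl// mulr_ge0.
apply: cvgD; first exact: cvg_cst.
by apply: cvgMr; exact: norm_continuous.
Qed.

Lemma inv_affine_normr_itv (R : realType) (a b x : R) : 1 <= a -> 0 <= b ->
  0 <= (a + b * `|x|)^-1 <= 1.
Proof.
move=> a1 b0; have h : 1 <= a + b * `|x| by rewrite ler_wpDr// mulr_ge0.
by rewrite invr_ge0 (le_trans ler01 h) invf_le1// (lt_le_trans ltr01 h).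
Qed.

Lemma mulr_itv01 (R : realType) (x y : R) :
  0 <= x <= 1 -> 0 <= y <= 1 -> 0 <= x * y <= 1.
Proof.
by move=> /andP[x0 x1] /andP[y0 y1]; rewrite mulr_ge0//= mulr_ile1.
Qed.

Lemma integrable_inv_affine d (T : measurableType d) (R : realType)
    (P : probability T R) (t : R) (z : T -> R) : 0 < t ->
  P.-integrable setT (EFin \o z) -> (forall w, 0 <= z w) ->
  P.-integrable setT (EFin \o (fun w => (1 + t * z w)^-1)).
Proof.
move=> t0 iz z0.
have mz : measurable_fun setT z by apply/measurable_EFinP; case/integrableP: iz.
have -> : (fun w => (1 + t * z w)^-1) = (fun w => (1 + t * `|z w|)^-1 * 1).
  by apply/funext => w; rewrite mulr1 ger0_norm.
apply: bounded_mul_integrable => [|w|]; last exact: finite_measure_integrable_cst.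
  exact: (measurableT_comp (measurable_inv_affine_normr ltr01 (ltW t0)) mz).
exact: (inv_affine_normr_itv (z w) (lexx 1) (ltW t0)).
Qed.

(** * The expected gain in one step *)

Section one_step.
Context d (T : measurableType d) (R : realType) (P : probability T R).
Variables (x y : T -> R) (c delta : R).
Hypotheses (ix : P.-integrable setT (EFin \o x))
           (iy : P.-integrable setT (EFin \o y)).
Hypotheses (c0 : 0 < c) (delta0 : 0 < delta).
Hypotheses (x0 : forall w, 0 <= x w) (y0 : forall w, 0 <= y w).
Hypothesis xy : forall w, x w = 0 -> y w = 0.
Hypothesis xyc : {ae P, forall w, `|y w - x w| <= c}.
Hypothesis hdrift : forall B, measurable B ->
  0 <= \int[P]_(w in x @^-1` B) (x w - y w).
Hypothesis hvar : forall B, measurable B ->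
  0 <= \int[P]_(w in x @^-1` B) (`|y w - x w| - delta * (0 < x w)%R%:R).

Let mx : measurable_fun setT x.
Proof. by apply/measurable_EFinP; case/integrableP: ix. Qed.

Let ipos : P.-integrable setT (EFin \o (fun w => (0 < x w)%R%:R)).
Proof.
rewrite (_ : (fun w => _) = \1_(x @^-1` `]0, +oo[%classic)).
  apply: integrable_indic; rewrite -[_ @^-1` _]setTI; exact: mx.
apply/funext => w; rewrite indicE (_ : (w \in _) = (0 < x w)%R)//.
by apply/idP/idP; rewrite inE/= in_itv/= andbT.
Qed.

(** Integrate the pointwise inequality: the drift term and the term in [|y - x| - delta] have
    nonnegative integrals, by [hdrift] and [hvar] extended from indicators to weights in [[0, 1]],
    and may be dropped. *)
Lemma Rintegral_inv_affine_increment (t : R) : 0 < t -> t <= 1 ->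
  t ^+ 2 * delta ^+ 2 * (4 * (2 + c))^-1 *
    (\int[P]_w (0 < x w)%R%:R - t * \int[P]_w x w) <=
  \int[P]_w (1 + t * y w)^-1 - \int[P]_w (1 + t * x w)^-1.
Proof.
move=> t0 t1.
(* [g] and [h] are the weights of these two terms. *)
pose g (r : R) := (1 + t * `|r|)^-1 ^+ 2.
pose h (r : R) := g r * (1 + t * c + t * `|r|)^-1.
have tc : 0 < t * c by rewrite mulr_gt0.
have mV : measurable_fun setT (fun r : R => (1 + t * `|r|)^-1).
  by apply: measurable_inv_affine_normr => //; exact: ltW.
have V01 (r : R) : 0 <= (1 + t * `|r|)^-1 <= 1.
  exact: (inv_affine_normr_itv r (lexx 1) (ltW t0)).
have mg : measurable_fun setT g by exact: measurable_funX.
have g01 (r : R) : 0 <= g r <= 1 by rewrite /g expr2; exact: mulr_itv01.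
have mh : measurable_fun setT h.
  apply: measurable_funM => //; apply: measurable_inv_affine_normr; last exact: ltW.
  by rewrite addr_gt0.
have h01 (r : R) : 0 <= h r <= 1.
  by apply: mulr_itv01 => //; apply: inv_affine_normr_itv; [rewrite lerDl|]; exact: ltW.
have iW1 : P.-integrable setT (EFin \o (fun w => x w - y w)).
  exact: integrable_subr.
have iW2 : P.-integrable setT
    (EFin \o (fun w => `|y w - x w| - delta * (0 < x w)%R%:R)).
  apply: integrable_subr => //; last exact: integrable_scaler.
  by apply: integrable_normr; exact: integrable_subr.
have i1 : P.-integrable setT (EFin \o (fun w => g (x w) * (x w - y w))).
  by apply: bounded_mul_integrable => //; exact: (measurableT_comp mg mx).
have i2 : P.-integrable setT (EFin \o (fun w => h (x w) *
    (`|y w - x w| - delta * (0 < x w)%R%:R))).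
  by apply: bounded_mul_integrable => //; exact: (measurableT_comp mh mx).
have E1 := Rintegral_comp_mul_ge0 mx iW1 hdrift mg g01.
have E2 := Rintegral_comp_mul_ge0 mx iW2 hvar mh h01.
set k := t ^+ 2 * delta ^+ 2 * (4 * (2 + c))^-1.
have i3 : P.-integrable setT (EFin \o (fun w => (0 < x w)%R%:R - t * x w)).
  by apply: integrable_subr => //; exact: integrable_scaler.
have is1 := integrable_scaler t measurableT i1.
have is2 := integrable_scaler (2 * delta * t ^+ 2) measurableT i2.
have is3 := integrable_scaler k measurableT i3.
have is12 := integrable_addr measurableT is1 is2.
have is123 := integrable_addr measurableT is12 is3.
have ify := integrable_inv_affine t0 iy y0.
have ifx := integrable_inv_affine t0 ix x0.
have if_ := integrable_subr measurableT ify ifx.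
have : 0 <= \int[P]_w (((1 + t * y w)^-1 - (1 + t * x w)^-1) -
    (t * (g (x w) * (x w - y w)) + 2 * delta * t ^+ 2 *
     (h (x w) * (`|y w - x w| - delta * (0 < x w)%R%:R)) +
     k * ((0 < x w)%R%:R - t * x w))).
  apply: ae_Rintegral_ge0 => //; first exact: integrable_subr.
  apply: filterS xyc => w dc _; rewrite subr_ge0.
  rewrite /h /g (ger0_norm (x0 w)) [1 + t * c + _]addrAC.
  by apply: inv_affine_increment => //; exact: xy.
rewrite RintegralB// RintegralB// RintegralD// RintegralD//.
rewrite !RintegralZl// RintegralB//; last exact: integrable_scaler.
rewrite RintegralZl// subr_ge0; apply: le_trans.
rewrite lerDr addr_ge0// mulr_ge0//; first exact: ltW.
by rewrite !mulr_ge0// ?exprn_ge0// ltW.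
Qed.

End one_step.

(** * Conditional expectations and the hitting time *)

Lemma is_cond_exp_Rintegral d (T : measurableType d) (R : realType)
    (P : probability T R) (G : set (set T)) (X Y : T -> R) (A : set T) :
  is_cond_exp P G X Y -> G A -> \int[P]_(w in A) Y w = \int[P]_(w in A) X w.
Proof. by case=> _ _ h GA; rewrite /Rintegral h. Qed.

Lemma le_stopping_time_Z (T : Type) (R : realType) (X : nat -> T -> R) (w : T)
    (k : nat) :
  (k%:R%:E <= stopping_time_Z X w)%E <-> forall n, (n < k)%N -> 0 < X n w.
Proof.
rewrite /stopping_time_Z; case: pselect => [hit|nhit]; last first.
  rewrite leey; split => // _ n _; rewrite ltNge; apply/negP => Xn.
  by apply: nhit; exists n.
rewrite lee_fin ler_nat; case: ex_minnP => m Xm mmin; split => [km n nk|h].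
  rewrite ltNge; apply/negP => /mmin mn.
  by have := leq_trans (leq_trans nk km) mn; rewrite ltnn.
by rewrite leqNgt; apply/negP => /h; rewrite ltNge Xm.
Qed.

Lemma stopping_time_Z_lty (T : Type) (R : realType) (X : nat -> T -> R) (w : T) :
  (stopping_time_Z X w < +oo)%E <-> exists n, X n w <= 0.
Proof.
rewrite /stopping_time_Z; case: pselect => [hit|nhit].
  by rewrite ltry; split.
by rewrite ltxx; split.
Qed.

Lemma Rintegral_probability_cst d (T : measurableType d) (R : realType)
  (P : probability T R) (r : R) : \int[P]_w r = r.
Proof.
rewrite Rintegral_cst//.
rewrite [X in fine X](_ : _ = 1%E) ?mulr1//; exact: probability_setT.
Qed.

(** * Summation over the steps, tail bound and almost sure absorption *)

Theorem theorem5 (d : measure_display) (T : measurableType d) (R : realType)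
    (P : probability T R) (F : nat -> set (set T)) (X : nat -> T -> R)
    (hF : filtration F)
    (hX : supermartingale P F X)
    (hbounded : difference_bounded P X)
    (hX0 : exists x0 : R, forall w, X 0%N w = x0)
    (hX_ge0 : forall n w, 0 <= X n w)
    (hX_abs : forall n w, X n w = 0 -> X n.+1 w = 0)
    (hdelta : exists2 delta : R, 0 < delta &
      forall n, exists2 Y : T -> R,
        is_cond_exp P (F n) (fun w => `|X n.+1 w - X n w|) Y &
        {ae P, forall w, 0 < X n w -> delta <= Y w}) :
  P [set w | (stopping_time_Z X w < +oo)%E] = 1%E /\
  (fun k : nat => fine (P [set w | (k%:R%:E <= stopping_time_Z X w)%E]) : R^o)
    =O_\oo (fun k : nat => (Num.sqrt (k%:R : R))^-1 : R^o).
Proof.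
have [adX iX driftX] := hX.
have [c c0 bX] := hbounded; have [x0 X0E] := hX0.
have [delta delta0 varX] := hdelta.
have mX n : measurable_fun setT (X n).
  by apply/measurable_EFinP; case/integrableP: (iX n).
have mXB n B : measurable B -> measurable (X n @^-1` B).
  by move=> mB; rewrite -[_ @^-1` _]setTI; exact: mX.
have iXA n (A : set T) : measurable A -> P.-integrable A (EFin \o X n).
  by move=> mA; exact: integrableS (iX n).
have iD n (A : set T) : measurable A ->
    P.-integrable A (EFin \o (fun w => `|X n.+1 w - X n w|)).
  by move=> mA; apply: integrable_normr; apply: integrable_subr => //; exact: iXA.
have iY (Y : T -> R) (A : set T) : measurable A ->
    P.-integrable setT (EFin \o Y) -> P.-integrable A (EFin \o Y).
  by move=> mA; exact: integrableS.
have drift n B : measurable B ->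
    0 <= \int[P]_(w in X n @^-1` B) (X n w - X n.+1 w).
  move=> mB; have [Y cY leY] := driftX n; have [_ intY _] := cY.
  have mA := mXB n B mB.
  rewrite RintegralB//; try exact: iXA.
  rewrite -(is_cond_exp_Rintegral cY (adX n B mB)) -RintegralB//;
    [|exact: iXA|exact: iY].
  apply: ae_Rintegral_ge0 => //; first by apply: integrable_subr; [|exact: iXA|exact: iY].
  by apply: filterS leY => w; rewrite subr_ge0.
pose pos : set R := `]0, +oo[%classic.
have mpos : measurable pos by exact: measurable_itv.
have var n B : measurable B -> 0 <= \int[P]_(w in X n @^-1` B)
    (`|X n.+1 w - X n w| - delta * (0 < X n w)%R%:R).
  move=> mB; have [Y cY leY] := varX n; have [_ intY _] := cY.
  have mA : measurable (X n @^-1` (B `&` pos)) by apply: mXB; exact: measurableI.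
  have AE : F n (X n @^-1` (B `&` pos)) by apply: adX; exact: measurableI.
  have iC (A : set T) r : measurable A -> P.-integrable A (EFin \o (fun=> r : R)).
    by move=> mA'; exact: finite_measure_integrable_cst.
  (* The lower bound [delta] is available only on [X n > 0]. Off this event absorption makes the
     integrand zero, so the integral reduces to [B] intersected with the positive half-line. *)
  have -> : \int[P]_(w in X n @^-1` B)
      (`|X n.+1 w - X n w| - delta * (0 < X n w)%R%:R) =
      \int[P]_(w in X n @^-1` (B `&` pos)) (`|X n.+1 w - X n w| - delta).
    rewrite preimage_setI Rintegral_mkcondr; apply: eq_Rintegral => w _.
    rewrite patchE; case: ifPn.
      by rewrite inE /pos/= in_itv/= andbT => ->; rewrite mulr1.
    rewrite notin_setE /pos/= in_itv/= andbT => /negP; rewrite -leNgt => Xle.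
    have X0 : X n w = 0 by apply/eqP; rewrite eq_le Xle hX_ge0.
    by rewrite X0 (hX_abs _ _ X0) ltxx subrr normr0 mulr0 subrr.
  rewrite RintegralB//; [|exact: iD|exact: iC].
  rewrite -(is_cond_exp_Rintegral cY AE) -RintegralB//; [|exact: iY|exact: iC].
  apply: ae_Rintegral_ge0 => //; first by apply: integrable_subr; [|exact: iY|exact: iC].
  apply: filterS leY => w leY [_]; rewrite /pos/= in_itv/= andbT => /leY.
  by rewrite subr_ge0.
have EX n : \int[P]_w X n w <= x0.
  elim: n => [|n]; last first.
    apply: le_trans; have := drift n setT measurableT.
    by rewrite preimage_setT RintegralB// subr_ge0.
  under eq_Rintegral do rewrite X0E.
  by rewrite Rintegral_probability_cst.
have x00 : 0 <= x0 by apply: le_trans (EX 0%N); exact: Rintegral_ge0.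
pose S k := [set w | (k%:R%:E <= stopping_time_Z X w)%E].
have SE k : S k = \bigcap_(n in `I_k) (X n @^-1` pos).
  apply/seteqP; split=> w /=.
    by move=> /le_stopping_time_Z h n /= /h; rewrite /pos/= in_itv/= andbT.
  move=> h; apply/le_stopping_time_Z => n /h.
  by rewrite /pos/= in_itv/= andbT.
have mS k : measurable (S k).
  by rewrite SE; apply: bigcap_measurableType => n _; exact: mXB.
pose q k := fine (P (S k)).
have Ppos n k : (n < k)%N -> q k <= \int[P]_w (0 < X n w)%R%:R.
  move=> nk.
  have -> : \int[P]_w (0 < X n w)%R%:R = fine (P (X n @^-1` pos)).
    rewrite /Rintegral -[X n @^-1` pos]setIT -integral_indic//; last exact: mXB.
    congr fine; apply: eq_integral => w _; rewrite indicE; congr (_%:R%:E).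
    by congr nat_of_bool; apply/idP/idP; rewrite inE /pos/= in_itv/= andbT.
  apply: fine_le; rewrite ?fin_num_measure//; try exact: mXB.
  apply: le_measure; rewrite ?inE//; first exact: mXB.
  by rewrite SE => w; apply.
pose K := delta ^+ 2 * (4 * (2 + c))^-1.
have K0 : 0 < K by rewrite mulr_gt0 ?exprn_gt0// invr_gt0 mulr_gt0// addr_gt0.
(* With [t = 1 / sqrt k], the sum over the steps will read [K * (q k - t * x0) <= t * x0], that is
   [q k <= t * C]. *)
pose C := x0 + x0 / K.
have C0 : 0 <= C by rewrite addr_ge0// divr_ge0// ltW.
have main k : (0 < k)%N -> q k <= C * (Num.sqrt (k%:R : R))^-1.
  move=> k0; have sk : 1 <= Num.sqrt (k%:R : R).
    by rewrite -[leLHS]sqrtr1 ler_sqrt// ?ler1n// ltr0n.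
  set s := Num.sqrt _ in sk *.
  have s0 : 0 < s by rewrite (lt_le_trans ltr01).
  have t0 : 0 < s^-1 by rewrite invr_gt0.
  have t1 : s^-1 <= 1 by rewrite invf_le1.
  (* The increments telescope. The same [q k] serves at every step [m < k], since [Z >= k] implies
     [X m > 0] for exactly these [m]. *)
  have sum m : (m <= k)%N ->
      m%:R * (s^-1 ^+ 2 * K * (q k - s^-1 * x0)) <=
      \int[P]_w (1 + s^-1 * X m w)^-1 - \int[P]_w (1 + s^-1 * X 0%N w)^-1.
    elim: m => [_|m IHm mk]; first by rewrite mul0r subrr.
    have h := Rintegral_inv_affine_increment (iX m) (iX m.+1) c0 delta0 (hX_ge0 m)
      (hX_ge0 m.+1) (hX_abs m) (bX m) (drift m) (var m) t0 t1.
    have : s^-1 ^+ 2 * K * (q k - s^-1 * x0) <= s^-1 ^+ 2 * delta ^+ 2 *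
       (4 * (2 + c))^-1 * (\int[P]_w (0 < X m w)%R%:R - s^-1 * \int[P]_w X m w).
      rewrite -[s^-1 ^+ 2 * _ * (4 * _)^-1]mulrA -/K.
      apply: ler_wpM2l; first by rewrite mulr_ge0 ?exprn_ge0 ?ltW.
      by apply: lerB; [exact: Ppos|rewrite ler_pM2l//; exact: EX].
    by move: h (IHm (ltnW mk)); rewrite -natr1 mulrDl mul1r; lra.
  have u0 : \int[P]_w (1 + s^-1 * X 0%N w)^-1 = (1 + s^-1 * x0)^-1.
    under eq_Rintegral do rewrite X0E.
    by rewrite Rintegral_probability_cst.
  have u1 : \int[P]_w (1 + s^-1 * X k w)^-1 <= 1.
    rewrite -[leRHS](Rintegral_probability_cst P); apply: le_Rintegral => //.
    - exact: integrable_inv_affine.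
    - exact: finite_measure_integrable_cst.
    - move=> w _; have tX : 0 <= s^-1 * X k w by rewrite mulr_ge0// ltW.
      by rewrite invf_le1 ?ltr_pwDl// lerDl.
  have u2 : 1 - (1 + s^-1 * x0)^-1 <= s^-1 * x0.
    have tx : 0 <= s^-1 * x0 by rewrite mulr_ge0// ltW.
    rewrite lerBlDr -lerBlDl -[leRHS]mul1r ler_pdivlMr ?ltr_pwDl//.
    nra.
  (* This is what the choice of [t] achieves: [k] gains of order [t^2] add up to order one. *)
  have ks : (k%:R : R) * s^-1 ^+ 2 = 1.
    by rewrite exprVn sqr_sqrtr ?ler0n// mulfV// pnatr_eq0 -lt0n.
  have := sum k (leqnn k); rewrite u0.
  have -> : k%:R * (s^-1 ^+ 2 * K * (q k - s^-1 * x0)) =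
      k%:R * s^-1 ^+ 2 * (K * (q k - s^-1 * x0)) by rewrite !mulrA.
  rewrite ks mul1r => hk.
  have : q k - s^-1 * x0 <= s^-1 * x0 / K.
    by rewrite ler_pdivlMr// mulrC; lra.
  by rewrite /C mulrDl [x0 * s^-1]mulrC [x0 / K * _]mulrAC [x0 * s^-1]mulrC; lra.
split; last first.
  (* The constant must be positive, whereas [C] vanishes when [x0 = 0]. The bound starts at [k = 1]:
     at [k = 0] the inverse square root is [0] by convention, while the probability is [1]. *)
  apply/eqO_exP; exists (C + 1); first by rewrite ltr_wpDl.
  exists 1%N => // k /= k1.
  rewrite ger0_norm ?fine_ge0// ger0_norm ?invr_ge0 ?sqrtr_ge0//.
  apply: (le_trans (main k k1)); rewrite ler_wpM2r ?invr_ge0 ?sqrtr_ge0//.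
  by rewrite lerDl.
(* Never being absorbed means lying in every [S k], an event of probability at most [q k] for each
   [k], hence zero by the tail bound. *)
have -> : [set w | (stopping_time_Z X w < +oo)%E] = ~` (\bigcap_k S k).
  apply/seteqP; split=> w /=.
    move=> /stopping_time_Z_lty[n Xn] /(_ n.+1 I) /le_stopping_time_Z /(_ n (ltnSn n)).
    by rewrite ltNge Xn.
  move=> nS; apply/stopping_time_Z_lty; apply: contrapT => nX.
  apply: nS => k _; apply/le_stopping_time_Z => n _; rewrite ltNge.
  by apply/negP => Xn; apply: nX; exists n.
have mI : measurable (\bigcap_k S k) by apply: bigcapT_measurable.
rewrite probability_setC//; suff -> : P (\bigcap_k S k) = 0%E by rewrite sube0.
apply/eqP; rewrite eq_le measure_ge0 andbT.
rewrite -[P _]fineK ?fin_num_measure// lee_fin.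
apply/ler_addgt0Pl => e e0; rewrite addr0.
(* Chosen so that [sqrt k >= C / e], which makes [C / sqrt k] at most [e]. *)
pose k := (Num.truncn ((C / e) ^+ 2)).+1.
have ck : (C / e) ^+ 2 < k%:R by exact: truncnS_gt.
have Ce : 0 <= C / e by rewrite divr_ge0// ltW.
have sk : C / e <= Num.sqrt (k%:R : R).
  by rewrite -[leLHS]ger0_norm// -sqrtr_sqr ler_sqrt ?ler0n// ltW.
apply: (@le_trans _ _ (q k)).
  apply: fine_le; rewrite ?fin_num_measure//.
  by apply: le_measure; rewrite ?inE// => w; apply.
apply: (le_trans (main k isT)); rewrite ler_pdivrMr ?sqrtr_gt0 ?ltr0n//.
by rewrite mulrC -ler_pdivrMr.
Qed.
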